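(* Let $a,c\in\mathbb R$ with $a^2>c^2$, let $K,\varepsilon_0>0$, let $d=i\kappa$ with $\kappa\in\mathbb R$, $|\kappa|\le K$, and assume the non-coalescence condition: there is $\gamma>0$ with $|\zeta(\varepsilon,i\kappa)|\ge\gamma$ for all $|\kappa|\le K$ and $0\le\varepsilon\le\varepsilon_0$. Let $R_{\rm SFRC}(h,\varepsilon)=\Pi_sS_\varepsilon\Pi_s+e^{hL_\varepsilon}\Pi_f$ be the slow–fast response corrected one-step map for the Jin–Xin Fourier block with derivative eigenvalue $d$. Then for every $T>0$, $$\max_{0\le nh\le T}\bigl\|R_{\rm SFRC}(h,\varepsilon)^nU^0-e^{nhL_\varepsilon}U^0\bigr\|\le C_Th^4\|U^0\|$$ for all $0<\varepsilon\le\varepsilon_0$ and all sufficiently small $h>0$ (the smallness threshold being independent of $\varepsilon$), with $C_T$ independent of $\varepsilon$ and $h$ (it may depend on $K,a,c,T,\varepsilon_0,\gamma$). The result holds for arbitrary modal initial data $U^0\in\mathbb C^2$.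
   Context: Jin–Xin Fourier block: for the system $u_t+v_x=0$, $v_t+a^2u_x=(cu-v)/\varepsilon$, the Fourier mode with derivative eigenvalue $d=i\kappa$ has split matrices $$A=\begin{pmatrix}0&-d\\-a^2d&0\end{pmatrix},\quad B=\frac1\varepsilon\begin{pmatrix}0&0\\c&-1\end{pmatrix},\quad L_\varepsilon=A+B.$$ Its eigenvalues solve $\varepsilon\lambda^2+\lambda+cd-\varepsilon a^2d^2=0$. Set $\zeta(\varepsilon,d)=\sqrt{1-4\varepsilon cd+4\varepsilon^2a^2d^2}$, the branch continuous in $\varepsilon$ with $\zeta(0,d)=1$, and $$\lambda_s(\varepsilon,d)=\frac{2(\varepsilon a^2d^2-cd)}{1+\zeta(\varepsilon,d)},\qquad \lambda_f=-\varepsilon^{-1}-\lambda_s.$$ The slow spectral projector (onto the $\lambda_s$-eigenspace of $L_\varepsilon$ along the $\lambda_f$-eigenspace) is $$\Pi_s=\frac1\zeta\begin{pmatrix}1+\varepsilon\lambda_s&-\varepsilon d\\c-\varepsilon a^2d&\varepsilon\lambda_s\end{pmatrix},\qquad \Pi_f=I-\Pi_s.$$ The base step is $S_\varepsilon=S(h;A,B)$ where, with $L=A+B$, $$P_*=\Bigl(I-\tfrac h2B+\tfrac{h^2}{8}BL\Bigr)^{-1}\Bigl(I+\tfrac h2A+\tfrac{h^2}{8}AL\Bigr),$$ $$S(h;A,B)=\Bigl(I-hB+\tfrac{h^2}{6}BL\Bigr)^{-1}\Bigl[I+hA+\tfrac{h^2}{6}AL+\tfrac{h^2}{3}(A-B)LP_*\Bigr].$$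 Norms are a fixed norm on $\mathbb C^2$ and its operator norm; $n$ ranges over nonnegative integers. *)

(* Defs.v *)
From HB Require Import structures.
From mathcomp Require Import all_boot all_order all_algebra.
From mathcomp Require Import all_classical all_reals all_analysis.
From mathcomp Require Import complex.

Set Implicit Arguments.
Unset Strict Implicit.
Unset Printing Implicit Defensive.

Import Order.TTheory GRing.Theory Num.Theory.
Import numFieldNormedType.Exports.

Local Open Scope classical_set_scope.
Local Open Scope ring_scope.
Local Open Scope complex_scope.

(* MathComp-Analysis puts the usual topology on [K^o] for every numFieldType K;
   transporting it to [R[i]] lets [lim] and [continuous] be used directly on
   complex numbers and complex matrices. *)
#[warnings="-redundant-canonical-projection"]
HB.instance Definition _ (R : realType) := NormedModule.copy R[i] R[i]^o.

Section JinXin.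
Variable R : realType.
Local Notation C := R[i].

Definition mx2 (p q r s : C) : 'M[C]_2 :=
  \matrix_(i, j) if i == 0 then (if j == 0 then p else q)
                 else (if j == 0 then r else s).

Definition expmx (M : 'M[C]_2) : 'M[C]_2 :=
  limn (series (fun k => (k`!%:R)^-1 *: M ^+ k)).

(* The second axiom is an identity in R[i], where the modulus takes its
   values. *)
Definition is_norm (N : 'cV[C]_2 -> R) : Prop :=
  [/\ forall x y, N (x + y) <= N x + N y,
      forall (l : C) x, (N (l *: x))%:C = `|l| * (N x)%:C
    & forall x, N x = 0 -> x = 0].

Definition mxA (a : R) (d : C) : 'M[C]_2 :=
  mx2 0 (- d) (- (a%:C ^+ 2 * d)) 0.

Definition mxB (c eps : R) : 'M[C]_2 :=
  eps%:C^-1 *: mx2 0 0 c%:C (- 1).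

Definition mxL (a c eps : R) (d : C) : 'M[C]_2 := mxA a d + mxB c eps.

(* z is the branch on [0, eps0], continuous in eps and equal to 1 at eps = 0,
   of sqrt (1 - 4 eps c d + 4 eps^2 a^2 d^2). *)
Definition zeta_branch (a c eps0 : R) (d : C) (z : R -> C) : Prop :=
  [/\ {within `[0, eps0], continuous z},
      z 0 = 1
    & forall eps, 0 <= eps <= eps0 ->
        z eps ^+ 2 = 1 - 4 * eps%:C * c%:C * d
                       + 4 * eps%:C ^+ 2 * a%:C ^+ 2 * d ^+ 2].

(* In the next definitions z stands for the value zeta (eps, d). *)
Definition lambda_s (a c eps : R) (d z : C) : C :=
  2 * (eps%:C * a%:C ^+ 2 * d ^+ 2 - c%:C * d) / (1 + z).

Definition Pi_s (a c eps : R) (d z : C) : 'M[C]_2 :=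
  z^-1 *: mx2 (1 + eps%:C * lambda_s a c eps d z) (- (eps%:C * d))
              (c%:C - eps%:C * a%:C ^+ 2 * d) (eps%:C * lambda_s a c eps d z).

Definition Pi_f (a c eps : R) (d z : C) : 'M[C]_2 := 1 - Pi_s a c eps d z.

Definition stage (h : R) (A B : 'M[C]_2) : 'M[C]_2 :=
  let L := A + B in
  (1 - (h / 2)%:C *: B + (h ^+ 2 / 8)%:C *: (B * L))^-1
  * (1 + (h / 2)%:C *: A + (h ^+ 2 / 8)%:C *: (A * L)).

Definition base_step (h : R) (A B : 'M[C]_2) : 'M[C]_2 :=
  let L := A + B in
  (1 - h%:C *: B + (h ^+ 2 / 6)%:C *: (B * L))^-1
  * (1 + h%:C *: A + (h ^+ 2 / 6)%:C *: (A * L)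
       + (h ^+ 2 / 3)%:C *: ((A - B) * L * stage h A B)).

Definition R_SFRC (a c h eps : R) (d z : C) : 'M[C]_2 :=
  Pi_s a c eps d z * base_step h (mxA a d) (mxB c eps) * Pi_s a c eps d z
  + expmx (h%:C *: mxL a c eps d) * Pi_f a c eps d z.

End JinXin.

(* Main.v *)
Require Import Defs.
From HB Require Import structures.
From mathcomp Require Import all_boot all_order all_algebra.
From mathcomp Require Import all_classical all_reals all_analysis.
From mathcomp Require Import complex.
From mathcomp Require Import ring lra.

(** The slow projector P = Pi_s is a rank-one idempotent commuting with
L = A + B, and L = lambda_s P + lambda_f (1 - P). The fast component is
propagated exactly, and P S P is a multiple r P because P has rank one.
Hence
[[
  R_SFRC ^+ n - exp (n h L) = (r ^ n - exp (h lambda_s) ^ n) P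
]]
and everything reduces to the scalar estimate
|r - exp (h lambda_s)| <= C h^5, uniform in eps, followed by the usual
telescoping of r^n - exp (h lambda_s)^n over at most T / h steps. The fast
exponential cancels, so that no bound on it enters.

For the scalar estimate ([step_op_slow]) the key is that B has rank one: B
is quasi-idempotent, both implicit matrices act on the range of B by scalars
D1, D2, and P B P = beta P. Expanding S on the slow eigenspace gives
exactly
[[
  r = (Taylor polynomial of degree 4 of exp at h lambda_s)
      + (terms of order h^5, all containing the factor beta).
]]
Two facts make the remainder uniform in the stiffness. First, the slow
eigenvector almost lies in the kernel of B: although B is of size 1 / eps,
beta is of size eps (definition [slow_beta], lemma [Pi_s_mxB]). Second,
d is imaginary and c real, so that |D1| and |D2| are at least the stiff
polynomials 1 + x/2 + x^2/8 and 1 + x + x^2/6 in x = h / eps ([den_ge]), and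
these absorb every power of x produced by the expansion
([slow_defect_le]).

The remaining ingredients are the bound on lambda_s, which requires 1 + zeta
to stay away from 0: the non-coalescence condition and the intermediate
value theorem keep Re zeta positive ([Re_zeta_gt0]); the complex exponential
as a power series, with its addition formula, growth bound and Taylor
remainder; and the comparison of an arbitrary norm on C^2 with the moduli of
the coordinates ([norm_mulmx_le]). *)

Set Implicit Arguments.
Unset Strict Implicit.
Unset Printing Implicit Defensive.

Import Order.TTheory GRing.Theory Num.Theory.
Import numFieldNormedType.Exports.
Import ComplexField.Normc.

Local Open Scope classical_set_scope.
Local Open Scope ring_scope.
Local Open Scope complex_scope.

(** * Modulus and convergence of complex numbers *)

Section ComplexModulus.
Variable R : realType.
Local Notation C := R[i].
Implicit Types (x y z l : C) (u : nat -> C) (X Y : R).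

Lemma normcE_norm z : `|z| = (normc z)%:C.
Proof. by []. Qed.

Lemma normc_ge0 z : 0 <= normc z.
Proof. by case: z => a b; apply: sqrtr_ge0. Qed.

Lemma normcX z n : normc (z ^+ n) = normc z ^+ n.
Proof. by apply: complexI; rewrite rmorphXn -!normcE_norm normrX. Qed.

Lemma normc_real (a : R) : normc a%:C = `|a|.
Proof. by rewrite /normc /= expr0n addr0 sqrtr_sqr. Qed.

Lemma normc_natr n : normc (n%:R : C) = n%:R.
Proof. by rewrite -(rmorph_nat (real_complex R)) normc_real normr_nat. Qed.

Lemma normc_subC x y : normc (x - y) = normc (y - x).
Proof. by rewrite -(normcN (x - y)) opprB. Qed.

Lemma le_normc_sum (I : Type) (r : seq I) (P : pred I) (F : I -> C) :
  normc (\sum_(i <- r | P i) F i) <= \sum_(i <- r | P i) normc (F i).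
Proof.
elim/big_rec2: _ => [|i a z _ le_za]; first by rewrite normc0.
by rewrite (le_trans (le_normcD _ _)) // lerD2l.
Qed.

Lemma le_dist_normc x y : `|normc x - normc y| <= normc (x - y).
Proof.
rewrite ler_norml lerNl opprB !lerBlDr; apply/andP; split.
  by rewrite normc_subC (le_trans _ (le_normcD _ _)) // subrK.
by rewrite (le_trans _ (le_normcD _ _)) // subrK.
Qed.

Lemma le_normc_ReIm z : normc z <= `|complex.Re z| + `|complex.Im z|.
Proof.
rewrite {1}(complexE z) (le_trans (le_normcD _ _)) // lerD ?normc_real //.
by rewrite normcM normc_real /normc /= expr0n add0r expr1n sqrtr1 mul1r.
Qed.

Lemma le_Re_normc x : `|complex.Re x| <= normc x.
Proof. by rewrite -lecR -normcE_norm normc_ge_Re. Qed.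

Lemma le_Im_normc x : `|complex.Im x| <= normc x.
Proof.
by case: x => p q /=; rewrite -sqrtr_sqr ler_wsqrtr// lerDr sqr_ge0.
Qed.

Lemma normcD_le x y X Y : normc x <= X -> normc y <= Y -> normc (x + y) <= X + Y.
Proof. by move=> xX yY; rewrite (le_trans (le_normcD _ _)) // lerD. Qed.

Lemma normcB_le x y X Y : normc x <= X -> normc y <= Y -> normc (x - y) <= X + Y.
Proof. by move=> xX yY; apply: normcD_le; rewrite ?normcN. Qed.

Lemma normcM_le x y X Y : normc x <= X -> normc y <= Y -> normc (x * y) <= X * Y.
Proof. by move=> xX yY; rewrite normcM ler_pM ?normc_ge0. Qed.

Lemma normcX_le x X n : normc x <= X -> normc (x ^+ n) <= X ^+ n.
Proof. by move=> xX; rewrite normcX lerXn2r ?nnegrE ?(le_trans _ xX) ?normc_ge0. Qed.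

Lemma normcV_le x X : 0 < X -> X <= normc x -> normc x^-1 <= X^-1.
Proof. by move=> X0 Xx; rewrite normcV lef_pV2 ?posrE // (lt_le_trans X0). Qed.

(** In R[i] the radius of a ball is itself a complex number, positive only
when real; this brings convergence back to the reals. *)
Lemma cvg_normcP u l :
  (u n @[n --> \oo] --> l) <-> (normc (u n - l) @[n --> \oo] --> (0 : R)).
Proof.
split=> [/cvgrPdist_lt ul|/cvgrPdist_lt ul]; apply/cvgrPdist_lt => e e0.
  have /ul : 0 < e%:C :> C by rewrite ltcR.
  apply: filterS => n; rewrite normcE_norm ltcR sub0r normrN normc_subC.
  by rewrite ger0_norm ?normc_ge0.
have /andP[/eqP eI eR] : (complex.Im e == 0) && (0 < complex.Re e).
  by move: e0; rewrite ltcE /= => /andP[/eqP-> ->]; rewrite eqxx.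
have /ul := eR; apply: filterS => n; rewrite sub0r normrN ger0_norm ?normc_ge0 //.
by rewrite normcE_norm ltcE /= eI eqxx normc_subC.
Qed.

Lemma cvg_normc u l : u n @[n --> \oo] --> l -> normc (u n) @[n --> \oo] --> normc l.
Proof.
move=> /cvg_normcP ul; apply/cvgrPdist_lt => e e0.
move/cvgrPdist_lt: ul => /(_ e e0); apply: filterS => n.
rewrite sub0r normrN ger0_norm ?normc_ge0 // => /(le_lt_trans _); apply.
by rewrite normc_subC le_dist_normc.
Qed.

Lemma cvg_complex u (a b : R) :
  complex.Re (u n) @[n --> \oo] --> a -> complex.Im (u n) @[n --> \oo] --> b ->
  u n @[n --> \oo] --> a +i* b.
Proof.
move=> ua ub; apply/cvg_normcP.
apply: (@squeeze_cvgr _ _ _ _ (fun=> 0)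
  (fun n => `|complex.Re (u n) - a| + `|complex.Im (u n) - b|)).
- near=> n; rewrite normc_ge0 (le_trans (le_normc_ReIm _)) //.
  by case: (u n).
- exact: cvg_cst.
- rewrite -[X in _ --> X]addr0; apply: cvgD.
    apply/norm_cvg0P; rewrite -(subrr a).
    by apply: cvgB => //; exact: cvg_cst.
  apply/norm_cvg0P; rewrite -(subrr b).
  by apply: cvgB => //; exact: cvg_cst.
Unshelve. all: by end_near. Qed.

(** Completeness of the complex numbers, in the form used below: a bound that
only sees moduli makes the real and imaginary parts converge at once. *)
Lemma cvgn_complex u :
  (forall f : {additive C -> R}, (forall x, `|f x| <= normc x) ->
     cvgn (fun n => f (u n))) ->
  exists l, u n @[n --> \oo] --> l.
Proof.
move=> u_cvg; have cRe := u_cvg (@complex.Re R) le_Re_normc.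
have cIm := u_cvg (@complex.Im R) le_Im_normc.
by eexists; apply: (cvg_complex cRe cIm).
Qed.

End ComplexModulus.

(** * The complex exponential *)

Section ExponentialSums.
Variable F : numFieldType.
Implicit Types (x y z : F).

(** Over a general field, so that a complex partial sum can be compared with the
real one at its modulus. *)
Definition exp_sum z (n : nat) : F := \sum_(0 <= k < n) (k`!%:R)^-1 * z ^+ k.

Local Notation term z k := ((k`!%:R)^-1 * z ^+ k).

Lemma exp_termD x y n :
  term (x + y) n = \sum_(0 <= i < n.+1) term x i * term y (n - i)%N.
Proof.
rewrite addrC exprDn mulr_sumr big_mkord; apply: eq_bigr => i _.
have /(congr1 (fun m => m%:R : F)) := bin_fact (ltnSE (ltn_ord i)).
rewrite !natrM => <-; have f0 m : m`!%:R != 0 :> F by rewrite pnatr_eq0 -lt0n fact_gt0.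
have b0 : 'C(n, i)%:R != 0 :> F by rewrite pnatr_eq0 -lt0n bin_gt0 -ltnS.
rewrite -[X in _ * X = _]mulr_natr; move: (f0 i) (f0 (n - i)%N) b0.
move: (i`!%:R) ((n - i)`!%:R) ('C(n, i)%:R) (x ^+ i) (y ^+ (n - i)) => a b c p q a0 b0 c0.
by field; rewrite a0 b0 c0.
Qed.

Lemma exp_sumD x y n : exp_sum (x + y) n
  = \sum_(0 <= i < n) \sum_(0 <= j < n - i) term x i * term y j.
Proof.
rewrite /exp_sum; elim: n => [|n IH]; first by rewrite !big_geq.
rewrite big_nat_recr //= IH exp_termD.
rewrite [in RHS]big_nat_recr //= subSnn big_nat1.
rewrite [in LHS]big_nat_recr //= subnn addrA; congr (_ + _).
rewrite -big_split /= !big_nat; apply: eq_bigr => i /andP[_ lin].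
by rewrite subSn ?(ltnW lin) // [in RHS]big_nat_recr.
Qed.

(** The defect of the addition formula consists of the products of terms with
i, j < n <= i + j. Their number does not matter: taking moduli termwise gives
the same defect at `|x| and `|y|, which vanishes in the limit by the addition
formula of the real exponential. *)
Lemma exp_sum_mul_dist x y n :
  `|exp_sum x n * exp_sum y n - exp_sum (x + y) n|
  <= exp_sum `|x| n * exp_sum `|y| n - exp_sum (`|x| + `|y|) n.
Proof.
have E u v : exp_sum u n * exp_sum v n - exp_sum (u + v) n
    = \sum_(0 <= i < n) \sum_(n - i <= j < n) term u i * term v j.
  apply/eqP; rewrite subr_eq exp_sumD -big_split /= /exp_sum mulr_suml.
  apply/eqP; apply: eq_bigr => i _.
  by rewrite mulr_sumr addrC -big_cat_nat // leq_subr.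
rewrite !E (le_trans (ler_norm_sum _ _ _)) // ler_sum // => i _.
rewrite (le_trans (ler_norm_sum _ _ _)) // ler_sum // => j _.
by rewrite !normrM !normrX !normfV !normr_nat.
Qed.

End ExponentialSums.

Section ComplexExponential.
Variable R : realType.
Local Notation C := R[i].
Implicit Types (x y z : C).

Definition cexp z : C := limn (exp_sum z).

Lemma exp_sum_real (a : R) n : exp_sum a%:C n = (exp_sum a n)%:C.
Proof.
rewrite /exp_sum rmorph_sum /=; apply: eq_bigr => k _.
by rewrite rmorphM fmorphV rmorph_nat rmorphXn.
Qed.

Lemma exp_sum_expR (a : R) : exp_sum a n @[n --> \oo] --> expR a.
Proof.
have -> : exp_sum a = series (exp_coeff a).
  by apply/funext => n; rewrite /exp_sum seriesEnat; apply: eq_bigr => k _; rewrite mulrC.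
exact: is_cvg_series_exp_coeff.
Qed.

Lemma le_normc_exp_sum z n : normc (exp_sum z n) <= exp_sum (normc z) n.
Proof.
rewrite (le_trans (le_normc_sum _ _ _)) // ler_sum // => k _.
by rewrite normcM normcX normcV normc_natr.
Qed.

Lemma cvg_exp_sum z : exp_sum z n @[n --> \oo] --> cexp z.
Proof.
have [|l zl] := @cvgn_complex _ (exp_sum z); last by apply/cvg_ex; exists l.
move=> f f_le.
have -> : (fun n => f (exp_sum z n)) = series (fun k => f ((k`!%:R)^-1 * z ^+ k)).
  by apply/funext => n; rewrite seriesEnat raddf_sum.
apply: normed_cvg; apply: (@series_le_cvg _ _ (exp_coeff (normc z))) => //.
- by move=> n; apply: normr_ge0.
- by move=> n; apply: exp_coeff_ge0; apply: normc_ge0.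
- move=> n; rewrite (le_trans (f_le _)) // normcM normcX normcV.
  by rewrite normc_natr mulrC.
- exact: is_cvg_series_exp_coeff.
Qed.

Lemma cexpD x y : cexp (x + y) = cexp x * cexp y.
Proof.
apply/eqP; rewrite eq_sym -subr_eq0; apply/eqP/eq0_normc/eqP.
rewrite eq_le normc_ge0 andbT.
have cvgR : exp_sum (normc x) n * exp_sum (normc y) n
      - exp_sum (normc x + normc y) n @[n --> \oo] --> (0 : R).
  rewrite -(subrr (expR (normc x + normc y))) {1}expRD.
  by apply: cvgB; [apply: cvgM|]; apply: exp_sum_expR.
have cvgC : normc (exp_sum x n * exp_sum y n - exp_sum (x + y) n) @[n --> \oo]
    --> normc (cexp x * cexp y - cexp (x + y)).
  apply: cvg_normc; apply: cvgB; last exact: cvg_exp_sum.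
  by apply: (@cvgM C); apply: cvg_exp_sum.
apply: (ler_cvg_to cvgC cvgR); near=> n.
rewrite -lecR -normcE_norm (le_trans (exp_sum_mul_dist _ _ _)) //.
by rewrite !normcE_norm -!rmorphD /= !exp_sum_real -rmorphM -rmorphB.
Unshelve. all: by end_near. Qed.

Lemma cexpMn z n : cexp (n%:R * z) = cexp z ^+ n.
Proof.
elim: n => [|n IH]; last by rewrite mulrSr mulrDl mul1r cexpD IH exprSr.
rewrite mul0r expr0; apply/cvg_lim => //.
apply: cvg_near_cst; near=> n; have /prednK <- : (0 < n)%N by near: n; exists 1%N.
rewrite /exp_sum big_nat_recl // big1 ?addr0 ?expr0 ?mulr1 ?invr1 // => k _.
by rewrite expr0n mulr0.
Unshelve. all: by end_near. Qed.

Lemma le_normc_cexp z : normc (cexp z) <= expR (normc z).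
Proof.
apply: (ler_cvg_to (cvg_normc (@cvg_exp_sum z)) (@exp_sum_expR _)).
by near=> n; apply: le_normc_exp_sum.
Unshelve. all: by end_near. Qed.

(** Taylor remainder of order 5: since k! <= (k + 5)!, the tail is
z^5 times a series dominated by that of the exponential. *)
Lemma cexp_taylor z :
  normc (cexp z - exp_sum z 5) <= normc z ^+ 5 * expR (normc z).
Proof.
have ctail : normc (exp_sum z (n + 5) - exp_sum z 5) @[n --> \oo]
    --> normc (cexp z - exp_sum z 5).
  apply: cvg_normc; apply: cvgB; last exact: cvg_cst.
  have := @cvg_exp_sum z; rewrite -(cvg_shiftn 5); exact.
have cbound : normc z ^+ 5 * exp_sum (normc z) n @[n --> \oo]
    --> normc z ^+ 5 * expR (normc z).
  by apply: cvgM; [exact: cvg_cst|exact: exp_sum_expR].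
apply: (ler_cvg_to ctail cbound).
near=> n; rewrite /exp_sum (@big_cat_nat _ _ _ 5 0 (n + 5)) ?leq_addl //=
  [X in normc X]addrC addKr.
rewrite (le_trans (le_normc_sum _ _ _)) // -{1}[5%N]add0n big_addn addnK mulr_sumr.
apply: ler_sum => k _; rewrite normcM normcX normcV exprD mulrA mulrC.
rewrite ler_wpM2l ?exprn_ge0 ?normc_ge0 // ler_wpM2r ?exprn_ge0 ?normc_ge0 //.
rewrite normc_natr.
by rewrite lef_pV2 ?posrE ?ltr0n ?fact_gt0 // ler_nat leq_fact ?leq_addr.
Unshelve. all: by end_near. Qed.

End ComplexExponential.

(** * Exponential of a matrix with two complementary spectral projectors *)

Section MatrixExponential.
Variable R : realType.
Local Notation C := R[i].

Lemma spectral_pow (P : 'M[C]_2) (p q : C) (k : nat) : P * P = P ->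
  (p *: P + q *: (1 - P)) ^+ k = p ^+ k *: P + q ^+ k *: (1 - P).
Proof.
move=> PP; elim: k => [|k IH]; first by rewrite !expr0 !scale1r subrKC.
have PQ : P * (1 - P) = 0 by rewrite mulrBr mulr1 PP subrr.
have QP : (1 - P) * P = 0 by rewrite mulrBl mul1r PP subrr.
have QQ : (1 - P) * (1 - P) = 1 - P by rewrite mulrBr mulr1 QP subr0.
rewrite exprS IH mulrDl !mulrDr -!scalerAl -!scalerAr PP PQ QP QQ.
by rewrite !scaler0 addr0 add0r !scalerA -!exprS.
Qed.

Lemma expmx_spectral (P : 'M[C]_2) (p q : C) : P * P = P ->
  expmx (p *: P + q *: (1 - P)) = cexp p *: P + cexp q *: (1 - P).
Proof.
move=> PP; rewrite /expmx; apply/cvg_lim => //.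
have -> : series (fun k => (k`!%:R)^-1 *: (p *: P + q *: (1 - P)) ^+ k)
    = (fun n => exp_sum p n *: P + exp_sum q n *: (1 - P)).
  apply/funext => n; rewrite seriesEnat /exp_sum !scaler_suml -big_split /=.
  by apply: eq_bigr => k _; rewrite spectral_pow // scalerDr !scalerA.
by apply: cvgD; apply: cvgZr_tmp; apply: cvg_exp_sum.
Qed.

End MatrixExponential.

(** * An arbitrary norm on C^2 *)

Section NormEquivalence.
Variables (R : realType) (N : 'cV[R[i]]_2 -> R).
Hypothesis normN : is_norm N.
Local Notation C := R[i].

Let ND x y : N (x + y) <= N x + N y. Proof. by case: normN. Qed.

Let NZ (l : C) x : N (l *: x) = normc l * N x.
Proof. by case: normN => _ h _; apply: complexI; rewrite h rmorphM. Qed.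

Let N_eq0 x : N x = 0 -> x = 0. Proof. by case: normN => _ _; apply. Qed.

Let NN x : N (- x) = N x.
Proof. by rewrite -scaleN1r NZ normcN normc1 mul1r. Qed.

Lemma is_norm_ge0 x : 0 <= N x.
Proof.
have := ND x (- x); rewrite subrr NN -{1}(scale0r 0) NZ normc0 mul0r.
by rewrite -mulr2n pmulrn_lge0.
Qed.

(** The distance from u to the line spanned by v is positive, even though
nothing relates N to the topology of C^2: along a minimizing sequence
u + t_n v the triangle inequality makes t_n a Cauchy sequence of scalars,
and N vanishes at its limit. *)
Lemma norm_line_gt0 (u v : 'cV[C]_2) : (forall t, u + t *: v != 0) ->
  exists2 m, 0 < m & forall t, m <= N (u + t *: v).
Proof.
move=> uv; have [v0|v0] := eqVneq v 0.
  exists (N u); last by move=> t; rewrite v0 scaler0 addr0.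
  rewrite lt_def is_norm_ge0 andbT; apply: contraNneq (uv 0) => /N_eq0 ->.
  by rewrite scale0r addr0.
have Nv : 0 < N v by rewrite lt_def is_norm_ge0 andbT; apply: contra_neq v0 => /N_eq0.
apply: contrapT => no_m.
have /choice[t t_lt] n : exists t, N (u + t *: v) < n.+1%:R^-1.
  apply: contrapT => no_t; apply: no_m; exists n.+1%:R^-1.
    by rewrite invr_gt0 ltr0n.
  by move=> t; rewrite leNgt; apply/negP => lt; apply: no_t; exists t.
have t_cauchy n k : (n <= k)%N -> normc (t n - t k) <= 2 * n.+1%:R^-1 / N v.
  move=> le_nk; rewrite ler_pdivlMr // -NZ.
  have -> : (t n - t k) *: v = (u + t n *: v) - (u + t k *: v).
    by rewrite scalerBl opprD addrACA subrr add0r.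
  rewrite (le_trans (ND _ _)) // NN mulrDl !mul1r lerD ?(ltW (t_lt _)) //.
  rewrite (le_trans (ltW (t_lt _))) // lef_pV2 ?posrE ?ltr0n //.
  by rewrite ler_nat.
have [|l /cvg_normcP t_l] := @cvgn_complex _ t.
  move=> f f_le; apply/cauchy_cvgP; apply: cauchy_exP => e e0.
  have [n n_lt] : exists n, 2 * n.+1%:R^-1 / N v < e.
    have [n _ /(_ n (leqnn _)) n_lt] := near_infty_natSinv_lt
      (PosNum (divr_gt0 (mulr_gt0 e0 Nv) (ltr0n _ 2))).
    by exists n; rewrite ltr_pdivrMr // mulrC -ltr_pdivlMr.
  exists (f (t n)); exists n => // k /= le_nk; rewrite /ball /=.
  by rewrite -raddfB (le_lt_trans (f_le _)) // (le_lt_trans (t_cauchy _ _ le_nk)).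
have /negP := uv l; apply; apply/eqP/N_eq0/eqP; rewrite eq_le is_norm_ge0 andbT.
have bound : n.+1%:R^-1 + normc (t n - l) * N v @[n --> \oo] --> (0 + 0 * N v : R).
  apply: cvgD; first exact: cvg_harmonic.
  by apply: cvgM => //; exact: cvg_cst.
rewrite mul0r addr0 in bound.
apply: (ler_cvg_to (cvg_cst (N (u + l *: v))) bound).
near=> n; rewrite -NZ -[N (_ *: _)]NN.
have -> : u + l *: v = (u + t n *: v) + - ((t n - l) *: v).
  by rewrite scalerBl opprB -addrA subrKC.
by rewrite (le_trans (ND _ _)) // lerD2r ltW.
Unshelve. all: by end_near. Qed.

(** Factoring out x turns x u + y v into a point of the line u + t v. *)
Lemma norm_coord_le (u v : 'cV[C]_2) : (forall t, u + t *: v != 0) ->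
  exists2 m, 0 < m & forall x y, m * normc x <= N (x *: u + y *: v).
Proof.
move=> /norm_line_gt0[m m0 m_le]; exists m => // x y.
have [->|x0] := eqVneq x 0; first by rewrite normc0 mulr0 is_norm_ge0.
have -> : x *: u + y *: v = x *: (u + (y / x) *: v).
  by rewrite scalerDr scalerA mulrCA divff // mulr1.
by rewrite NZ mulrC ler_wpM2l ?normc_ge0.
Qed.

Lemma norm_mulmx_le : exists2 c, 0 <= c & forall (M : 'M[C]_2) (m : R) U,
  (forall i j, normc (M i j) <= m) -> N (M *m U) <= c * m * N U.
Proof.
pose e i : 'cV[C]_2 := delta_mx i 0.
have eE (U : 'cV[C]_2) : U = U 0 0 *: e 0 + U 1 0 *: e 1.
  apply/matrixP => i j; rewrite !mxE ord1; case: i => -[|[|//]] ilt /=.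
    by rewrite mulr1 mulr0 addr0; congr (U _ _); apply: val_inj.
  by rewrite mulr1 mulr0 add0r; congr (U _ _); apply: val_inj.
have e01 t : e 0 + t *: e 1 != 0.
  apply/eqP => /matrixP/(_ 0 0)/eqP.
  by rewrite !mxE /= mulr0 addr0 oner_eq0.
have e10 t : e 1 + t *: e 0 != 0.
  apply/eqP => /matrixP/(_ 1 0)/eqP.
  by rewrite !mxE /= mulr0 addr0 oner_eq0.
have [m0 m0_gt0 m0P] := norm_coord_le e01; have [m1 m1_gt0 m1P] := norm_coord_le e10.
exists ((m0^-1 + m1^-1) * (N (e 0) + N (e 1))).
  by rewrite mulr_ge0 ?addr_ge0 ?invr_ge0 ?is_norm_ge0 // ltW.
move=> M m U Mm; have m_ge0 : 0 <= m := le_trans (normc_ge0 _) (Mm 0 0).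
have U0 : normc (U 0 0) <= m0^-1 * N U.
  by rewrite ler_pdivlMl // {2}(eE U).
have U1 : normc (U 1 0) <= m1^-1 * N U.
  by rewrite ler_pdivlMl // {2}(eE U) addrC.
have MU i : normc ((M *m U) i 0) <= m * ((m0^-1 + m1^-1) * N U).
  rewrite mxE (le_trans (le_normc_sum _ _ _)) // big_ord_recl big_ord1 mulrDl mulrDr.
  have -> : lift ord0 ord0 = 1 :> 'I_2 by apply: val_inj.
  by rewrite lerD // normcM ler_pM ?normc_ge0.
rewrite (eE (M *m U)) (le_trans (ND _ _)) // !NZ.
have -> : (m0^-1 + m1^-1) * (N (e 0) + N (e 1)) * m * N U
  = m * ((m0^-1 + m1^-1) * N U) * N (e 0) + m * ((m0^-1 + m1^-1) * N U) * N (e 1) by ring.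
by rewrite lerD // ler_wpM2r ?is_norm_ge0.
Qed.

End NormEquivalence.

(** * The base step compressed by a spectral projector *)

(** Geometric series: the powers of W are multiples of W. *)
Lemma inv_1sub_quasi_idem (F : fieldType) (V : unitAlgType F) (W : V) (w : F) :
  W * W = w *: W -> w != 1 -> (1 - W)^-1 = 1 + (1 - w)^-1 *: W.
Proof.
move=> WW w1; have u0 : 1 - w != 0 by rewrite subr_eq0 eq_sym.
have wE : (1 - w)^-1 * w = (1 - w)^-1 - 1 by field.
have rV : (1 - W) * (1 + (1 - w)^-1 *: W) = 1.
  rewrite mulrDr mulr1 mulrBl mul1r -scalerAr WW scalerA wE scalerBl scale1r.
  by rewrite opprB subrKC subrK.
have lV : (1 + (1 - w)^-1 *: W) * (1 - W) = 1.
  rewrite mulrDl mul1r mulrBr mulr1 -scalerAl WW scalerA wE scalerBl scale1r.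
  by rewrite opprB subrKC subrK.
have U : 1 - W \is a GRing.unit by apply/unitrP; exists (1 + (1 - w)^-1 *: W).
by rewrite -[RHS](mulKr U) rV mulr1.
Qed.

Section SlowMultiplier.
Variables (F : numFieldType) (k : nat) (A B P : 'M[F]_k.+1).
Variables (h lam beta m0 m1 m2 m3 : F).
Local Notation L := (A + B).

(** The scalars by which the implicit matrices of the stage and of the step
act on the range of B, given B * B = m0 B and B * L * B = m1 B. *)
Definition stage_den : F := 1 - (h / 2 * m0 - h ^+ 2 / 8 * m1).
Definition step_den : F := 1 - (h * m0 - h ^+ 2 / 6 * m1).

Definition taylor4 (y : F) : F :=
  1 + y + y ^+ 2 / 2 + y ^+ 3 / 6 + y ^+ 4 / 24.

(** The value of the multiplier found in [step_op_slow]; apart from the Taylor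
polynomial every term carries beta, and hence vanishes when B does on the
slow eigenspace. *)
Definition slow_mult : F :=
  let y := h * lam in
  taylor4 y + h / step_den * (y ^+ 4 / 72 - y ^+ 5 / 144) * beta
  - h ^+ 6 * lam ^+ 3 * beta / (192 * stage_den)
    * (lam ^+ 2 - (2 * m1 - h * m2 + h ^+ 2 / 6 * m3) / step_den).

(* The scalars beta, m0, ..., m3 exist whenever P is an idempotent of rank one
   and B has rank one. *)
Hypotheses (LP : L * P = lam *: P) (PL : P * L = lam *: P) (PP : P * P = P).
Hypotheses (PBP : P * B * P = beta *: P).
Hypotheses (BB : B * B = m0 *: B) (BLB : B * L * B = m1 *: B).
Hypotheses (BL2B : B * L * L * B = m2 *: B) (BL3B : B * L * L * L * B = m3 *: B).
Hypotheses (den1 : stage_den != 0) (den2 : step_den != 0).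

(* [scalerAl] and [scalerAr] restricted to matrices: the scalars are
   themselves an algebra, whose products are left alone. *)
Let scaleMl (t : F) (U V : 'M[F]_k.+1) : (t *: U) * V = t *: (U * V).
Proof. by rewrite scalerAl. Qed.

Let scaleMr (t : F) (U V : 'M[F]_k.+1) : U * (t *: V) = t *: (U * V).
Proof. by rewrite scalerAr. Qed.

Let X := B * P.

Let AP : A * P = lam *: P - X.
Proof. by rewrite -LP mulrDl addrK. Qed.

Let ALP : A * L * P = lam *: (lam *: P - X).
Proof. by rewrite -mulrA LP scaleMr AP. Qed.

Let BLP : B * L * P = lam *: X.
Proof. by rewrite -mulrA LP scaleMr. Qed.

Let BX : B * X = m0 *: X.
Proof. by rewrite /X mulrA BB -scaleMl. Qed.

Let BLX : B * L * X = m1 *: X.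
Proof. by rewrite /X mulrA BLB -scaleMl. Qed.

Lemma den_inv (s t : F) : let w := s * m0 - t * m1 in w != 1 ->
  (1 - s *: B + t *: (B * L))^-1
  = 1 + (1 - w)^-1 *: (s *: B - t *: (B * L)).
Proof.
move=> w w1; rewrite -inv_1sub_quasi_idem //; first by rewrite opprB addrA addrAC.
have WB : (s *: B - t *: (B * L)) * B = w *: B.
  by rewrite mulrBl !scaleMl BB BLB !scalerA -scalerBl.
by rewrite mulrBr !scaleMr mulrA WB scaleMl !scalerA scalerBr !scalerA ![w * _]mulrC.
Qed.

Definition stage_op : 'M[F]_k.+1 :=
  (1 - (h / 2) *: B + (h ^+ 2 / 8) *: (B * L))^-1
  * (1 + (h / 2) *: A + (h ^+ 2 / 8) *: (A * L)).

Definition step_op : 'M[F]_k.+1 :=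
  (1 - h *: B + (h ^+ 2 / 6) *: (B * L))^-1
  * (1 + h *: A + (h ^+ 2 / 6) *: (A * L)
       + (h ^+ 2 / 3) *: ((A - B) * L * stage_op)).

Let WP (s t : F) : (s *: B - t *: (B * L)) * P = (s - t * lam) *: X.
Proof. by rewrite mulrBl !scaleMl BLP scalerA -scalerBl. Qed.

Let WX (s t : F) : (s *: B - t *: (B * L)) * X = (s * m0 - t * m1) *: X.
Proof. by rewrite mulrBl !scaleMl BX BLX !scalerA -scalerBl. Qed.

Let NP (s t : F) : (1 + s *: A + t *: (A * L)) * P
  = (1 + (s + t * lam) * lam) *: P - (s + t * lam) *: X.
Proof.
rewrite [LHS]mulrDl [(1 + _) * P]mulrDl mul1r.
rewrite !scaleMl ALP AP.
by apply/matrixP=> i j; rewrite !mxE; ring.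
Qed.

(** The component along B P is as small as h^4: with alpha = h/2 + h^2 lam/8 and
alpha' = h/2 - h^2 lam/8, its coefficient is
(alpha' (1 + alpha lam) - alpha) / stage_den, where the terms in h and h^2
cancel. *)
Lemma stage_op_slow : stage_op * P =
  (1 + h * lam / 2 + (h * lam) ^+ 2 / 8) *: P
  - (h ^+ 4 * lam ^+ 3 / (64 * stage_den)) *: (B * P).
Proof.
rewrite /stage_op den_inv; last by rewrite -subr_eq0 -opprB oppr_eq0.
rewrite -[LHS]mulrA NP mulrDl mul1r scaleMl mulrBr !scaleMr WP WX -/X.
rewrite -/stage_den; have -> : h / 2 * m0 - h ^+ 2 / 8 * m1 = 1 - stage_den.
  by rewrite /stage_den; ring.
apply/matrixP=> i j; rewrite !mxE; move: (P i j) (X i j) den1 => p x.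
by move: stage_den => d1 d10; field.
Qed.

(** On the eigenspace the explicit factor of the step is a combination of P, B P
and L^2 B P; the implicit factor only adds multiples of B P, and the final
multiplication by P turns all three into multiples of P. *)
Lemma step_op_slow : P * step_op * P = slow_mult *: P.
Proof.
have L2X : P * (L * L * X) = (lam ^+ 2 * beta) *: P.
  by rewrite /X !mulrA PL !scaleMl PL !scaleMl PBP !scalerA expr2.
have PX : P * X = beta *: P by rewrite /X mulrA PBP.
have BL2X : B * (L * L * X) = m2 *: X by rewrite /X !mulrA BL2B -scaleMl.
have BL3X : B * L * (L * L * X) = m3 *: X by rewrite /X !mulrA BL3B -scaleMl.
have WLLX (s t : F) : (s *: B - t *: (B * L)) * (L * L * X) = (s * m2 - t * m3) *: X.
  by rewrite mulrBl !scaleMl BL2X BL3X !scalerA -scalerBl.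
have compress (s t e a b c : F) :
    P * ((1 + e *: (s *: B - t *: (B * L))) * (a *: P + b *: X - c *: (L * L * X)))
    = (a + b * beta - c * (lam ^+ 2 * beta)
       + e * (a * (s - t * lam) + b * (s * m0 - t * m1) - c * (s * m2 - t * m3)) * beta) *: P.
  rewrite mulrDl mul1r scaleMl [(s *: B - _) * _]mulrBr [(s *: B - _) * (_ + _)]mulrDr.
  rewrite !scaleMr WP WX WLLX mulrDr mulrBr mulrDr !scaleMr PP PX L2X.
  rewrite mulrBr mulrDr !scaleMr PX.
  by apply/matrixP=> i j; rewrite !mxE; ring.
have CP : (A - B) * L * P = lam *: (lam *: P - 2 *: X).
  by rewrite -mulrA LP scaleMr mulrBl AP -addrA -opprD scaler_nat mulr2n.
have CX : (A - B) * L * X = L * L * X - (2 * m1) *: X.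
  have -> : A - B = L - 2 *: B by rewrite scaler_nat mulr2n opprD addrA addrK.
  by rewrite mulrBl mulrBl !scaleMl BLX scalerA.
rewrite /step_op den_inv; last by rewrite -subr_eq0 -opprB oppr_eq0.
rewrite -[LHS]mulrA -[X in P * X]mulrA.
rewrite [(_ + (h ^+ 2 / 3) *: _) * P]mulrDl NP scaleMl -[_ * stage_op * P]mulrA.
rewrite stage_op_slow -/X [(A - B) * L * _]mulrBr !scaleMr CP CX.
set V := (X in (1 + _) * X).
have -> : V = taylor4 (h * lam) *: P
   + (h ^+ 2 / 3 * (h ^+ 4 * lam ^+ 3 / (64 * stage_den)) * (2 * m1)
      - h * (1 + 5 / 6 * (h * lam) + (h * lam) ^+ 2 / 3 + (h * lam) ^+ 3 / 12)) *: X
   - (h ^+ 2 / 3 * (h ^+ 4 * lam ^+ 3 / (64 * stage_den))) *: (L * L * X).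
  rewrite /V; move: (L * L * X) => Y.
  apply/matrixP=> i j; rewrite !mxE; move: (P i j) (X i j) (Y i j) den1 => p x y.
  by rewrite /taylor4; move: stage_den => d1 d10; field.
rewrite [LHS]compress -/step_den.
have -> : h * m0 - h ^+ 2 / 6 * m1 = 1 - step_den.
  by rewrite /step_den; ring.
apply/matrixP=> i j; rewrite !mxE /slow_mult /taylor4; move: (P i j) den1 den2 => p.
by move: stage_den step_den => d1 d2 d10 d20; field; rewrite d10 d20.
Qed.
End SlowMultiplier.

(** * Spectral data of the Jin-Xin block *)

Section Mx2.
Variable R : realType.
Local Notation C := R[i].
Implicit Types p q r s : C.

Lemma mx2M p q r s p' q' r' s' : mx2 p q r s * mx2 p' q' r' s'
  = mx2 (p * p' + q * r') (p * q' + q * s') (r * p' + s * r') (r * q' + s * s').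
Proof.
apply/matrixP => i j; rewrite !mxE big_ord_recl big_ord1 !mxE /=.
by case: i j => -[|[|//]] ? [[|[|//]] ?].
Qed.

Lemma mx2D p q r s p' q' r' s' :
  mx2 p q r s + mx2 p' q' r' s' = mx2 (p + p') (q + q') (r + r') (s + s').
Proof.
by apply/matrixP => i j; rewrite !mxE; case: i j => -[|[|//]] ? [[|[|//]] ?].
Qed.

Lemma mx2Z t p q r s : t *: mx2 p q r s = mx2 (t * p) (t * q) (t * r) (t * s).
Proof.
by apply/matrixP => i j; rewrite !mxE; case: i j => -[|[|//]] ? [[|[|//]] ?].
Qed.

Lemma mx2_1 : 1 = mx2 1 0 0 1 :> 'M[C]_2.
Proof.
by apply/matrixP => i j; rewrite !mxE; case: i j => -[|[|//]] ? [[|[|//]] ?].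
Qed.

Lemma eq_mx2 p q r s p' q' r' s' : p = p' -> q = q' -> r = r' -> s = s' ->
  mx2 p q r s = mx2 p' q' r' s'.
Proof. by move=> -> -> -> ->. Qed.

End Mx2.

Section JinXinBlock.
Variables (R : realType) (a c eps : R) (d z : R[i]).
Local Notation C := R[i].
Hypothesis eps_neq0 : eps != 0.
Hypothesis zeta_sqr : z ^+ 2 = 1 - 4 * eps%:C * c%:C * d
                       + 4 * eps%:C ^+ 2 * a%:C ^+ 2 * d ^+ 2.
Hypotheses (z1_neq0 : 1 + z != 0) (z_neq0 : z != 0).

Local Notation A := (mxA a d).
Local Notation B := (mxB c eps).
Local Notation L := (mxL a c eps d).
Local Notation P := (Pi_s a c eps d z).
Local Notation lam := (lambda_s a c eps d z).
Local Notation e := (eps%:C : C).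

(** The lower left entry of zeta Pi_s. *)
Definition shear : C := c%:C - eps%:C * a%:C ^+ 2 * d.
Definition fast_eig : C := - e^-1 - lam.
(** The trace of B P. Computed directly it is - (eps c d + eps lambda_s) /
(eps zeta); the characteristic equation turns this into the present form,
which exhibits the factor eps on which the uniformity in eps rests. *)
Definition slow_beta : C := e * (lam ^+ 2 - a%:C ^+ 2 * d ^+ 2) / z.

(** B * L ^ k * B = (mu_k / eps ^ (k + 1)) B; these scaled moments are
polynomials in eps d, hence bounded uniformly in eps. *)
Definition mu1 : C := 1 - c%:C * (e * d).
Definition mu2 : C := c%:C * (e * d) - 1 + e * d * shear.
Definition mu3 : C := 1 - c%:C * (e * d) * (1 - e * d * shear) - 2 * (e * d * shear).

Let e0 : e != 0. Proof. by rewrite (fmorph_eq0 (real_complex R)). Qed.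

Lemma zetaE : z = 1 + 2 * (e * lam).
Proof.
rewrite /lambda_s; apply: (mulIf z1_neq0).
have -> : (1 + 2 * (e * (2 * (e * a%:C ^+ 2 * d ^+ 2 - c%:C * d) / (1 + z)))) * (1 + z)
   = 1 + z + (1 - 4 * e * c%:C * d + 4 * e ^+ 2 * a%:C ^+ 2 * d ^+ 2) - 1.
  by move: (a%:C) (c%:C) e => a' c' e'; field.
by rewrite -zeta_sqr; ring.
Qed.

(** The determinant of Pi_s vanishes: this is the characteristic equation
multiplied by eps. *)
Lemma shearE : e * d * shear = - (e * lam * (1 + e * lam)).
Proof.
have n4 : (4 : C) != 0 by rewrite pnatr_eq0.
apply: (mulfI n4); move: zeta_sqr; rewrite {1}zetaE /shear => E.
have -> : 4 * (e * d * (c%:C - e * a%:C ^+ 2 * d))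
  = 1 - (1 - 4 * e * c%:C * d + 4 * e ^+ 2 * a%:C ^+ 2 * d ^+ 2) by ring.
by rewrite -E; ring.
Qed.

Lemma slow_char : c%:C * d = e * a%:C ^+ 2 * d ^+ 2 - lam - e * lam ^+ 2.
Proof.
apply: (mulfI e0); have -> : e * (c%:C * d) = e * d * shear + e ^+ 2 * a%:C ^+ 2 * d ^+ 2.
  by rewrite /shear; ring.
by rewrite shearE; ring.
Qed.

Lemma Pi_s_entries : P = z^-1 *: mx2 (1 + e * lam) (- (e * d)) shear (e * lam).
Proof. by []. Qed.

Lemma Pi_s_idem : P * P = P.
Proof.
rewrite Pi_s_entries -scalerAl -scalerAr mx2M !mx2Z; have := shearE.
have zi : z^-1 * z = 1 by rewrite mulVf.
move: zetaE zi; move: (e * lam) (e * d) shear z^-1 => s q w zi -> {}zi1 qw.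
have E (x y : C) : x = (1 + 2 * s) * y -> zi * (zi * x) = zi * y.
  by move=> ->; rewrite mulrA -[zi * zi * _]mulrA [zi * (_ * y)]mulrA zi1 mul1r.
apply: eq_mx2; apply: E; [|by ring|by ring|].
  by rewrite mulNr qw; ring.
by rewrite mulrN [w * q]mulrC qw; ring.
Qed.

(** Since lambda_s - lambda_f = zeta / eps, the right-hand side is
lambda_f + (zeta / eps) P, in which zeta cancels the prefactor of P. All
spectral properties of L follow from this and the idempotence of P. *)
Lemma mxL_spectral : L = lam *: P + fast_eig *: (1 - P).
Proof.
have zE := zetaE.
have -> : lam *: P + fast_eig *: (1 - P) = fast_eig *: 1 + (z / e) *: P.
  rewrite scalerBr addrCA -scalerBl; congr (_ + _ *: _).
  by rewrite {2}zE /fast_eig; field; exact: e0.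
rewrite Pi_s_entries scalerA mulrAC divff // mul1r mx2_1 /mxL /mxA /mxB !(mx2Z, mx2D).
by apply: eq_mx2; rewrite /fast_eig /shear; field; exact: e0.
Qed.

Lemma mxL_Pi_s : L * P = lam *: P.
Proof.
rewrite mxL_spectral; move: Pi_s_idem; move: P => Q QQ.
by rewrite mulrDl -!scalerAl mulrBl mul1r QQ subrr scaler0 addr0.
Qed.

Lemma Pi_s_mxL : P * L = lam *: P.
Proof.
rewrite mxL_spectral; move: Pi_s_idem; move: P => Q QQ.
by rewrite mulrDr -!scalerAr mulrBr mulr1 QQ subrr scaler0 addr0.
Qed.

Lemma Pi_s_mxB : P * B * P = slow_beta *: P.
Proof.
have -> : slow_beta = - (c%:C * (e * d) + e * lam) / (e * z).
  have -> : c%:C * (e * d) = e * (c%:C * d) by ring.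
  by rewrite slow_char /slow_beta; move: z_neq0 e0; move: z e => z' e' z0 e0'; field; rewrite z0.
rewrite Pi_s_entries /mxB !(=^~ scalerAl, =^~ scalerAr) !mx2M !mx2Z; have := shearE.
move: z_neq0 e0; move: (e * lam) (e * d) shear => s q w z0 e0' qw.
have E (x y : C) : x = - (c%:C * q + s) * y ->
   z^-1 * (z^-1 * (e^-1 * x)) = - (c%:C * q + s) / (e * z) * (z^-1 * y).
  by move=> ->; field; rewrite z0.
apply: eq_mx2.
- apply: E; rewrite (_ : _ + _ = - (q * c%:C) * (1 + s) + q * w); last by ring.
  by rewrite qw; ring.
- by apply: E; ring.
- apply: E; rewrite (_ : _ + _ = s * (c%:C * (1 + s)) - s * w); last by ring.
  apply/eqP; rewrite -subr_eq0; apply/eqP.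
  rewrite [LHS](_ : _ = c%:C * (s * (1 + s) + q * w)); last by ring.
  by rewrite qw; ring.
- by apply: E; ring.
Qed.

Lemma mxB_mul2 : B * B = - e^-1 *: B.
Proof. by rewrite /mxB !(=^~ scalerAl, =^~ scalerAr) mx2M !mx2Z; apply: eq_mx2; field; exact: e0. Qed.

Lemma mxBLB : B * L * B = (mu1 / e ^+ 2) *: B.
Proof.
rewrite /mxL /mxA /mxB !mx2Z !mx2D !mx2M.
by apply: eq_mx2; rewrite /mu1; field; exact: e0.
Qed.

Lemma mxBL2B : B * L * L * B = (mu2 / e ^+ 3) *: B.
Proof.
rewrite /mxL /mxA /mxB !mx2Z !mx2D !mx2M.
by apply: eq_mx2; rewrite /mu2 /shear; field; exact: e0.
Qed.

Lemma mxBL3B : B * L * L * L * B = (mu3 / e ^+ 4) *: B.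
Proof.
rewrite /mxL /mxA /mxB !mx2Z !mx2D !mx2M.
by apply: eq_mx2; rewrite /mu3 /shear; field; exact: e0.
Qed.

End JinXinBlock.

(** * Uniform bound on the defect of the slow multiplier *)

Section SlowMultiplierDefect.
Variable F : numFieldType.

(** h^-5 times the deviation of the multiplier from the Taylor polynomial, for
beta = e b and m_k = k_k / e^(k + 1), arranged so that h / e occurs only in
quotients that the denominators D1 and D2 dominate. *)
Definition slow_defect (h lam b e k1 k2 k3 D1 D2 : F) : F :=
  e * b * lam ^+ 4 * (72^-1 - h * lam / 144) / D2
  - lam ^+ 3 * b / 192 * (h * e * lam ^+ 2 / D1
      - h / e / D1 * ((2 * k1 - h / e * k2 + (h / e) ^+ 2 / 6 * k3) / D2)).

Lemma slow_multE (h lam b e k1 k2 k3 : F) :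
  let D1 := stage_den h (- e^-1) (k1 / e ^+ 2) in
  let D2 := step_den h (- e^-1) (k1 / e ^+ 2) in
  e != 0 -> D1 != 0 -> D2 != 0 ->
  slow_mult h lam (e * b) (- e^-1) (k1 / e ^+ 2) (k2 / e ^+ 3) (k3 / e ^+ 4)
  - exp_sum (h * lam) 5 = h ^+ 5 * slow_defect h lam b e k1 k2 k3 D1 D2.
Proof.
move=> D1 D2 e0 D10 D20; rewrite /slow_mult -/D1 -/D2 /slow_defect.
have -> : taylor4 (h * lam) = exp_sum (h * lam) 5.
  rewrite /exp_sum !big_nat_recr //= big_geq // /taylor4 !factS fact0 !natrM.
  by field.
by move: D1 D2 (exp_sum _ _) D10 D20 => D1 D2 S D10 D20; field; rewrite e0 D10 D20.
Qed.
End SlowMultiplierDefect.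

Section SlowDefectBound.
Variables (R : realType).
Local Notation C := R[i].

(** Writing x = h / eps: x / D1 is bounded by 2 through the linear term of D1, and
2 k1 - x k2 + x^2 k3 / 6 is at most 2 M |D2| by comparing coefficients. *)
Lemma slow_defect_le (h eps : R) (lam b k1 k2 k3 D1 D2 : C) (E Lam Bb M : R) :
  0 < h <= 1 -> 0 < eps <= E ->
  normc lam <= Lam -> normc b <= Bb ->
  normc k1 <= M -> normc k2 <= M -> normc k3 <= M ->
  1 + h / eps / 2 <= normc D1 ->
  1 + h / eps + (h / eps) ^+ 2 / 6 <= normc D2 ->
  normc (slow_defect h%:C lam b eps%:C k1 k2 k3 D1 D2) <=
  E * Bb * Lam ^+ 4 * (1 + Lam) + Lam ^+ 3 * Bb * (E * Lam ^+ 2 + 4 * M).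
Proof.
move=> /andP[h0 h1] /andP[e0 eE] lamL bB k1M k2M k3M D1le D2le.
have x0 : 0 < h / eps by rewrite divr_gt0.
have Lam0 : 0 <= Lam := le_trans (normc_ge0 _) lamL.
have M0 : 0 <= M := le_trans (normc_ge0 _) k1M.
have B0 : 0 <= Bb := le_trans (normc_ge0 _) bB.
have hE : normc h%:C <= 1 by rewrite normc_real gtr0_norm.
have eE' : normc eps%:C <= E by rewrite normc_real gtr0_norm.
have E0 : 0 <= E := le_trans (normc_ge0 _) eE'.
have D1V : normc D1^-1 <= 1.
  rewrite -[leRHS]invr1; apply: normcV_le => //.
  by apply: le_trans D1le; rewrite lerDl divr_ge0 // ltW.
have D2V : normc D2^-1 <= 1.
  rewrite -[leRHS]invr1; apply: normcV_le => //.
  by apply: le_trans D2le; rewrite -addrA lerDl addr_ge0 ?divr_ge0 ?sqr_ge0 // ltW.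
have small (n : nat) : (0 < n)%N -> normc (n%:R^-1 : C) <= 1.
  by move=> n0; rewrite normcV normc_natr invf_le1 ?ltr0n // ler1n.
have xD1 : normc (h%:C / eps%:C / D1) <= 2.
  rewrite !(normcM, normcV) !normc_real !gtr0_norm // ler_pdivrMr; last first.
    by apply: lt_le_trans D1le; rewrite ltr_pwDl // divr_ge0 // ltW.
  rewrite (le_trans _ (ler_wpM2l _ D1le)) // mulrDr mulr1 [2 * _]mulrC divfK //.
  by rewrite lerDr.
have kD2 : normc ((2 * k1 - h%:C / eps%:C * k2 + (h%:C / eps%:C) ^+ 2 / 6 * k3) / D2)
    <= 2 * M.
  have D2_gt0 : 0 < normc D2.
    by apply: lt_le_trans D2le; rewrite !ltr_pwDl ?divr_ge0 ?sqr_ge0 ?ltW.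
  rewrite normcM normcV ler_pdivrMr //.
  have xE : normc (h%:C / eps%:C) <= h / eps.
    by rewrite normcM normcV !normc_real !gtr0_norm.
  apply: (@le_trans _ _ (2 * M + h / eps * M + (h / eps) ^+ 2 / 6 * M)).
    apply: normcD_le; first apply: normcB_le.
    - by apply: normcM_le; rewrite ?normc_natr.
    - exact: normcM_le.
    - apply: normcM_le => //; apply: normcM_le; first exact: normcX_le.
      by rewrite normcV normc_natr.
  apply: (@le_trans _ _ (2 * M * (1 + h / eps + (h / eps) ^+ 2 / 6))); last first.
    by rewrite ler_wpM2l // mulr_ge0.
  move: (h / eps) x0 => x x0.
  rewrite -subr_ge0 (_ : _ - _ = x * M + x ^+ 2 / 6 * M); last by ring.
  by rewrite addr_ge0 // mulr_ge0 ?divr_ge0 ?sqr_ge0 // ltW.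
rewrite /slow_defect; apply: normcB_le.
  rewrite -[leRHS]mulr1; apply: normcM_le => //; apply: normcM_le.
    by apply: normcM_le; [exact: normcM_le|exact: normcX_le].
  apply: normcB_le; first by apply: small.
  rewrite -[leRHS]mulr1; apply: normcM_le; last by apply: small.
  by rewrite -[leRHS]mul1r; apply: normcM_le.
apply: normcM_le.
  rewrite -[leRHS]mulr1; apply: normcM_le; last by apply: small.
  by apply: normcM_le => //; exact: normcX_le.
apply: normcB_le; last first.
  by rewrite (_ : 4 * M = 2 * (2 * M)); [exact: normcM_le|rewrite mulrA -natrM].
rewrite -[leRHS]mulr1; apply: normcM_le => //.
apply: normcM_le; last exact: normcX_le.
by rewrite -[leRHS]mul1r; apply: normcM_le.
Qed.
End SlowDefectBound.

(** * The branch of zeta has positive real part *)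

Section ZetaBranch.
Variables (R : realType) (a c eps0 gamma kappa : R) (z : R -> R[i]).
Local Notation C := R[i].
Hypothesis branch : zeta_branch a c eps0 (0 +i* kappa) z.
Hypotheses (gamma_gt0 : 0 < gamma)
  (z_ge : forall eps, 0 <= eps <= eps0 -> gamma%:C <= `|z eps|).

Lemma zeta_sqr_ReIm eps : 0 <= eps <= eps0 ->
  complex.Re (z eps) ^+ 2 - complex.Im (z eps) ^+ 2 = 1 - 4 * eps ^+ 2 * a ^+ 2 * kappa ^+ 2
  /\ 2 * (complex.Re (z eps) * complex.Im (z eps)) = - (4 * eps * c * kappa).
Proof.
case: branch => _ _ /[apply].
have -> : 1 - 4 * eps%:C * c%:C * (0 +i* kappa)
     + 4 * eps%:C ^+ 2 * a%:C ^+ 2 * (0 +i* kappa) ^+ 2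
   = (1 - 4 * eps ^+ 2 * a ^+ 2 * kappa ^+ 2) +i* (- (4 * eps * c * kappa)).
  rewrite -(rmorph_nat (real_complex R) 4) -!rmorphXn -!rmorphM.
  apply/eqP; rewrite eq_complex /=; apply/andP; split; apply/eqP; ring.
case: (z eps) => p q; rewrite expr2 => /eqP; rewrite eq_complex /= => /andP[/eqP <- /eqP <-].
by split; ring.
Qed.

Lemma continuous_Re : continuous (@complex.Re R : C -> R).
Proof.
move=> x; apply/(@cvgrPdist_lt _ _ _ (nbhs (x : C)) (nbhs_filter _)) => e e0.
have : nbhs x (ball x (e%:C : C)) by apply: nbhsx_ballx; rewrite ltcR.
apply: filterS => y; rewrite -ball_normE /= ltcR; apply: le_lt_trans.
by have := le_Re_normc (x - y); case: x y => ? ? [].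
Qed.

Lemma zeta_neq0 eps : 0 <= eps <= eps0 -> z eps != 0.
Proof.
move=> /z_ge; apply: contraTneq => ->.
by rewrite normr0 -[0]/(0%:C) lecR -ltNge.
Qed.

(** Were Re zeta to vanish at some t, the square of zeta would be real and
nonpositive there. Its imaginary part forces c = 0, and then zeta ^ 2 =
1 - 4 eps^2 a^2 kappa^2 already vanishes at some eps <= t, against the lower
bound on |zeta|. *)
Lemma Re_zeta_gt0 eps : 0 <= eps <= eps0 -> 0 < complex.Re (z eps).
Proof.
move=> /andP[e0 ee0]; rewrite ltNge; apply/negP => Re_le0.
have [zcont z0 _] := branch.
have Re_cont : {within `[0, eps], continuous (fun t => complex.Re (z t))}.
  have : {within `[0, eps0], continuous (fun t => complex.Re (z t))}.
    by move=> x; apply: continuous_comp; [exact: zcont|exact: continuous_Re].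
  by apply: continuous_subspaceW; apply: subset_itvl; rewrite bnd_simp.
have [|t] := IVT (v := 0) e0 Re_cont.
  by rewrite z0 ge_min le_max Re_le0 orbT /= ler01.
rewrite in_itv /= => /andP[t0 te] Ret.
have tI : 0 <= t <= eps0 by rewrite t0 (le_trans te).
have [] := zeta_sqr_ReIm tI; rewrite Ret expr0n mul0r mulr0 sub0r => Im2 /esym/eqP.
have s_ge1 : 1 <= (2 * t * `|a| * `|kappa|) ^+ 2.
  have : 0 <= complex.Im (z t) ^+ 2 by apply: sqr_ge0.
  rewrite !exprMn !real_normK ?num_real // -oppr_le0 Im2.
  by rewrite subr_le0 => /le_trans; apply; rewrite le_eqVlt; apply/orP; left; apply/eqP; ring.
have s0 : 0 < 2 * t * `|a| * `|kappa|.
  rewrite lt_def !mulr_ge0 // andbT; apply: contraTneq s_ge1 => ->.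
  by rewrite expr0n -ltNge ltr01.
have {}s_ge1 : 1 <= 2 * t * `|a| * `|kappa|.
  by move: s_ge1; rewrite expr_ge1 // ltW.
have ak0 : 0 < `|a| * `|kappa|.
  rewrite lt_def mulr_ge0 // andbT; apply: contraTneq s0 => ak0.
  by rewrite -mulrA ak0 mulr0 ltxx.
have t_gt0 : 0 < t.
  by rewrite lt_def t0 andbT; apply: contraTneq s0 => ->; rewrite mulr0 !mul0r ltxx.
have [a0 k0] : a != 0 /\ kappa != 0.
  by move: (lt0r_neq0 ak0); rewrite mulf_eq0 !normr_eq0 negb_or => /andP[].
rewrite oppr_eq0 !mulf_eq0 (gt_eqF t_gt0) (negPf k0) orbF pnatr_eq0 /= => /eqP c0.
(* coalescence for c = 0: 2 w |a| |kappa| = 1 *)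
pose w := (2 * (`|a| * `|kappa|))^-1.
have wI : 0 <= w <= eps0.
  apply/andP; split; first by rewrite invr_ge0 mulr_ge0 // ltW.
  apply: le_trans (le_trans te ee0); rewrite /w -[_^-1]mul1r ler_pdivrMr; last by rewrite mulr_gt0.
  by rewrite (_ : t * _ = 2 * t * `|a| * `|kappa|) //; ring.
have /negP := zeta_neq0 wI; apply; rewrite -sqrf_eq0.
case: branch => _ _ ->//; rewrite c0.
have -> : 1 - 4 * w%:C * 0%:C * (0 +i* kappa)
     + 4 * w%:C ^+ 2 * a%:C ^+ 2 * (0 +i* kappa) ^+ 2
   = (1 - 4 * w ^+ 2 * a ^+ 2 * kappa ^+ 2)%:C.
  rewrite -(rmorph_nat (real_complex R) 4) -!rmorphXn -!rmorphM.
  apply/eqP; rewrite eq_complex /=; apply/andP; split; apply/eqP; ring.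
have -> : 4 * w ^+ 2 * a ^+ 2 * kappa ^+ 2 = (2 * (`|a| * `|kappa|) * w) ^+ 2.
  by rewrite !exprMn !real_normK ?num_real //; ring.
by rewrite /w divff ?expr1n ?subrr // mulf_neq0 // lt0r_neq0.
Qed.

Lemma normc_1Dzeta_ge1 eps : 0 <= eps <= eps0 -> 1 <= normc (1 + z eps).
Proof.
move=> /Re_zeta_gt0 Re_gt0; apply: le_trans (le_Re_normc _).
by rewrite (le_trans _ (ler_norm _)) //; case: (z eps) Re_gt0 => p q /= /ltW; rewrite lerDl.
Qed.
End ZetaBranch.

(** * One step and its iterates *)

Section OneStep.
Variables (R : realType) (a c K eps0 gamma kappa eps h : R) (z : R[i]).
Local Notation C := R[i].
Local Notation d := (0 +i* kappa : C).
Hypotheses (eps_gt0 : 0 < eps) (eps_le : eps <= eps0) (h_gt0 : 0 < h) (h_le1 : h <= 1).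
Hypotheses (kappa_le : `|kappa| <= K) (gamma_gt0 : 0 < gamma).
Hypothesis zeta_sqr : z ^+ 2 = 1 - 4 * eps%:C * c%:C * d
                       + 4 * eps%:C ^+ 2 * a%:C ^+ 2 * d ^+ 2.
Hypotheses (z_ge : gamma <= normc z) (z1_ge : 1 <= normc (1 + z)).

Local Notation P := (Pi_s a c eps d z).
Local Notation lam := (lambda_s a c eps d z).
Local Notation e := (eps%:C : C).
Local Notation hC := (h%:C : C).

Definition lam_bound : R := 2 * (eps0 * a ^+ 2 * K ^+ 2 + `|c| * K).
Definition shear_bound : R := `|c| + eps0 * a ^+ 2 * K.
Definition mu_bound : R :=
  1 + `|c| * (eps0 * K) * (1 + eps0 * K * shear_bound) + 2 * (eps0 * K * shear_bound).
Definition beta_bound : R := (lam_bound ^+ 2 + a ^+ 2 * K ^+ 2) / gamma.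
Definition Pi_s_bound : R :=
  gamma^-1 * (1 + eps0 * lam_bound + eps0 * K + shear_bound).
Definition local_error_const : R :=
  eps0 * beta_bound * lam_bound ^+ 4 * (1 + lam_bound)
  + lam_bound ^+ 3 * beta_bound * (eps0 * lam_bound ^+ 2 + 4 * mu_bound)
  + lam_bound ^+ 5 * expR lam_bound.

Let eps_neq0 : eps != 0. Proof. exact: lt0r_neq0. Qed.

Let z_neq0 : z != 0.
Proof. by apply: contraTneq z_ge => ->; rewrite normc0 -ltNge. Qed.

Let z1_neq0 : 1 + z != 0.
Proof. by apply: contraTneq z1_ge => ->; rewrite normc0 -ltNge. Qed.

Let e_le : normc e <= eps0.
Proof. by rewrite normc_real gtr0_norm. Qed.

Let d_le : normc d <= K.
Proof. by rewrite /normc /= expr0n add0r sqrtr_sqr. Qed.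

Let c_le : normc c%:C <= `|c|.
Proof. by rewrite normc_real. Qed.

Let a2_le : normc (a%:C ^+ 2) <= a ^+ 2.
Proof. by rewrite normcX normc_real real_normK ?num_real. Qed.

Let ed_le : normc (e * d) <= eps0 * K.
Proof. exact: normcM_le. Qed.

Let lam_le : normc lam <= lam_bound.
Proof.
rewrite /lambda_s -[leRHS]mulr1; apply: normcM_le; last first.
  by rewrite -[leRHS]invr1; apply: normcV_le.
rewrite /lam_bound; apply: normcM_le; first by rewrite normc_natr.
apply: normcB_le; last exact: normcM_le.
by apply: normcM_le; [exact: normcM_le|exact: normcX_le].
Qed.

Let lam_bound_ge0 : 0 <= lam_bound := le_trans (normc_ge0 _) lam_le.

Let shear_le : normc (shear a c eps d) <= shear_bound.
Proof. by apply: normcB_le => //; apply: normcM_le => //; exact: normcM_le. Qed.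

Let qw_le : normc (e * d * shear a c eps d) <= eps0 * K * shear_bound.
Proof. exact: normcM_le. Qed.

Let cq_le : normc (c%:C * (e * d)) <= `|c| * (eps0 * K).
Proof. exact: normcM_le. Qed.

Let qw_bound_ge0 : 0 <= eps0 * K * shear_bound := le_trans (normc_ge0 _) qw_le.
Let cq_bound_ge0 : 0 <= `|c| * (eps0 * K) := le_trans (normc_ge0 _) cq_le.

Let mu_bound_ge : 1 + `|c| * (eps0 * K) + eps0 * K * shear_bound <= mu_bound.
Proof.
rewrite /mu_bound -subr_ge0.
move: (`|c| * _) (eps0 * K * _) cq_bound_ge0 qw_bound_ge0 => u v u0 v0.
by rewrite (_ : _ - _ = u * v + v); [rewrite addr_ge0 ?mulr_ge0|ring].
Qed.

Let mu1_le : normc (mu1 c eps d) <= mu_bound.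
Proof.
apply: le_trans mu_bound_ge; apply: (@le_trans _ _ (1 + `|c| * (eps0 * K))).
  by apply: normcB_le; rewrite ?normc1.
by rewrite lerDl.
Qed.

Let mu2_le : normc (mu2 a c eps d) <= mu_bound.
Proof.
apply: le_trans mu_bound_ge; rewrite [1 + _]addrC; apply: normcD_le => //.
by apply: normcB_le; rewrite ?normc1.
Qed.

Let mu3_le : normc (mu3 a c eps d) <= mu_bound.
Proof.
apply: normcB_le; last by apply: normcM_le; rewrite ?normc_natr.
apply: normcB_le; first by rewrite normc1.
by apply: normcM_le => //; apply: normcB_le; rewrite ?normc1.
Qed.

Let beta_le :
  normc ((lam ^+ 2 - a%:C ^+ 2 * d ^+ 2) / z) <= beta_bound.
Proof.
apply: normcM_le; last exact: normcV_le.
apply: normcB_le; first exact: normcX_le.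
by apply: normcM_le => //; exact: normcX_le.
Qed.

Lemma Pi_s_le i j : normc (P i j) <= Pi_s_bound.
Proof.
rewrite Pi_s_entries !mxE; apply: normcM_le; first exact: normcV_le.
have el_le : normc (e * lam) <= eps0 * lam_bound by apply: normcM_le.
have el_ge0 := le_trans (normc_ge0 _) el_le.
have q_ge0 := le_trans (normc_ge0 _) ed_le.
have w_ge0 := le_trans (normc_ge0 _) shear_le.
case: ifP => _; case: ifP => _.
- apply: (@le_trans _ _ (1 + eps0 * lam_bound)).
    by apply: normcD_le; rewrite ?normc1.
  by rewrite -addrA lerDl addr_ge0.
- by rewrite normcN (le_trans ed_le) //; lra.
- by rewrite (le_trans shear_le) //; lra.
- by rewrite (le_trans el_le) //; lra.
Qed.

(** The two denominators are the cases (s, t) = (x/2, x^2/8) and (x, x^2/6) with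
x = h / eps. Since d is imaginary, replacing mu1 = 1 - eps c d by 1 changes only the
imaginary part, and the modulus is at least the real part. *)
Lemma den_ge (s t : R) : 0 <= s -> 0 <= t ->
  1 + s + t <= normc (1 - (s%:C * e * (- e^-1) - t%:C * e ^+ 2 * (mu1 c eps d / e ^+ 2))).
Proof.
move=> s0 t0; have e0 : e != 0 by rewrite (fmorph_eq0 (real_complex R)).
have -> : 1 - (s%:C * e * (- e^-1) - t%:C * e ^+ 2 * (mu1 c eps d / e ^+ 2))
  = (1 + s + t)%:C - (t * c * eps)%:C * d.
  rewrite !rmorphD !rmorphM rmorph1 /= /mu1; move: e d e0 => e' d' e0.
  by move: (s%:C) (t%:C) (c%:C) => s' t' c'; field.
apply: le_trans (le_Re_normc _); apply: le_trans (ler_norm _).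
by rewrite /= mulr0 mul0r subrr oppr0 addr0.
Qed.

Definition step_multiplier : C :=
  slow_mult hC lam (slow_beta a c eps d z) (- e^-1)
    (mu1 c eps d / e ^+ 2) (mu2 a c eps d / e ^+ 3) (mu3 a c eps d / e ^+ 4).

Let D1 := stage_den hC (- e^-1) (mu1 c eps d / e ^+ 2).
Let D2 := step_den hC (- e^-1) (mu1 c eps d / e ^+ 2).

Let e_neq0 : e != 0. Proof. by rewrite (fmorph_eq0 (real_complex R)). Qed.

Let D1_ge : 1 + h / eps / 2 <= normc D1.
Proof.
apply: (@le_trans _ _ (1 + h / eps / 2 + (h / eps) ^+ 2 / 8)).
  by rewrite lerDl divr_ge0 ?sqr_ge0.
rewrite /D1 /stage_den.
have -> : hC / 2 = (h / eps / 2)%:C * e.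
  by rewrite !rmorphM !fmorphV rmorph_nat /=; field; exact: e_neq0.
have -> : hC ^+ 2 / 8 = ((h / eps) ^+ 2 / 8)%:C * e ^+ 2.
  by rewrite rmorphM rmorphXn rmorphM !fmorphV rmorph_nat /=; field; exact: e_neq0.
by apply: den_ge; rewrite ?divr_ge0 ?sqr_ge0 ?ltW.
Qed.

Let D2_ge : 1 + h / eps + (h / eps) ^+ 2 / 6 <= normc D2.
Proof.
rewrite /D2 /step_den.
have -> : hC ^+ 2 / 6 = ((h / eps) ^+ 2 / 6)%:C * e ^+ 2.
  by rewrite rmorphM rmorphXn rmorphM !fmorphV rmorph_nat /=; field; exact: e_neq0.
have {1}-> : hC = (h / eps)%:C * e.
  by rewrite rmorphM fmorphV /=; field; exact: e_neq0.
by apply: den_ge; rewrite ?divr_ge0 ?sqr_ge0 ?ltW.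
Qed.

Let x_gt0 : 0 < h / eps. Proof. exact: divr_gt0. Qed.

Let D1_neq0 : D1 != 0.
Proof.
apply: contraTneq D1_ge => ->; rewrite normc0 -ltNge ltr_pwDl //.
by rewrite divr_ge0 // ltW.
Qed.

Let D2_neq0 : D2 != 0.
Proof.
apply: contraTneq D2_ge => ->; rewrite normc0 -ltNge !ltr_pwDl ?divr_ge0 ?sqr_ge0 //;
  exact: ltW.
Qed.

Lemma base_stepE : base_step h (mxA a d) (mxB c eps) = step_op (mxA a d) (mxB c eps) hC.
Proof.
rewrite /base_step /step_op /stage /stage_op.
by rewrite !(rmorphXn, rmorphM, fmorphV, rmorph_nat).
Qed.

Lemma slow_base_step :
  P * base_step h (mxA a d) (mxB c eps) * P = step_multiplier *: P.
Proof.
rewrite base_stepE; apply: step_op_slow.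
- exact: mxL_Pi_s.
- exact: Pi_s_mxL.
- exact: Pi_s_idem.
- exact: Pi_s_mxB.
- exact: mxB_mul2.
- exact: mxBLB.
- exact: mxBL2B.
- exact: mxBL3B.
- exact: D1_neq0.
- exact: D2_neq0.
Qed.

Lemma step_multiplier_error :
  normc (step_multiplier - cexp (hC * lam)) <= local_error_const * h ^+ 5.
Proof.
have -> : step_multiplier - cexp (hC * lam)
  = (step_multiplier - exp_sum (hC * lam) 5) - (cexp (hC * lam) - exp_sum (hC * lam) 5).
  by rewrite opprB addrA subrK.
have h_norm : normc hC = h by rewrite normc_real gtr0_norm.
rewrite mulrDl; apply: normcB_le.
  rewrite /step_multiplier /slow_beta -mulrA slow_multE // normcM normcX h_norm mulrC.
  rewrite ler_wpM2r ?exprn_ge0 ?(ltW h_gt0) //.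
  by apply: slow_defect_le => //; rewrite ?h_gt0 ?eps_gt0.
have hl_le : normc (hC * lam) <= h * lam_bound by apply: normcM_le; rewrite ?h_norm.
apply: le_trans (cexp_taylor _) _.
rewrite [leRHS](_ : _ = (h * lam_bound) ^+ 5 * expR lam_bound); last by ring.
apply: ler_pM; rewrite ?exprn_ge0 ?normc_ge0 ?expR_ge0 //.
  by rewrite lerXn2r ?nnegrE ?normc_ge0 // (le_trans _ hl_le) ?normc_ge0.
by rewrite ler_expR (le_trans hl_le) // ler_piMl.
Qed.

(** The fast parts of both propagators are powers of the same exponential and
cancel. *)
Lemma R_SFRC_error (n : nat) :
  R_SFRC a c h eps d z ^+ n - expmx ((n%:R * h)%:C *: mxL a c eps d)
  = (step_multiplier ^+ n - cexp (hC * lam) ^+ n) *: P.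
Proof.
have PP : P * P = P by exact: Pi_s_idem.
have LE t : t *: mxL a c eps d
    = (t * lam) *: P + (t * fast_eig a c eps d z) *: (1 - P).
  by rewrite (mxL_spectral eps_neq0 zeta_sqr z1_neq0 z_neq0) scalerDr !scalerA.
rewrite /R_SFRC slow_base_step /Pi_f !LE !expmx_spectral // rmorphM rmorph_nat /=.
rewrite -!mulrA !cexpMn; move: P PP => Q QQ.
rewrite mulrDl -!scalerAl mulrBr mulr1 QQ subrr scaler0 add0r.
have -> : (1 - Q) * (1 - Q) = 1 - Q by rewrite mulrBr mulr1 mulrBl mul1r QQ subrr subr0.
by rewrite spectral_pow // opprD addrACA subrr addr0 scalerBl.
Qed.

(** Telescoping: n <= T / h steps cost one power of h. Both bases are at most
exp (h (lam_bound + local_error_const)), so that their n-th powers stay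
bounded. *)
Lemma multiplier_pow_error (T : R) (n : nat) : n%:R * h <= T ->
  normc (step_multiplier ^+ n - cexp (hC * lam) ^+ n)
  <= T * local_error_const * expR (T * (lam_bound + local_error_const)) * h ^+ 4.
Proof.
move=> nhT; set r := step_multiplier; set E := cexp _; set C1 := local_error_const.
have err := step_multiplier_error; rewrite -/r -/E -/C1 in err.
have h5_gt0 : 0 < h ^+ 5 by rewrite exprn_gt0.
have C1_ge0 : 0 <= C1 by rewrite -(pmulr_lge0 _ h5_gt0) (le_trans (normc_ge0 _) err).
pose G := expR (h * (lam_bound + C1)).
have E_le : normc E <= expR (h * lam_bound).
  rewrite (le_trans (le_normc_cexp _)) // ler_expR.
  by apply: normcM_le => //; rewrite normc_real gtr0_norm.
have EG : normc E <= G.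
  apply: (le_trans E_le); rewrite ler_expR; apply: ler_wpM2l; first exact: ltW.
  by rewrite lerDl.
have rG : normc r <= G.
  rewrite -[r](subrK E) addrC (le_trans (le_normcD _ _)) //.
  rewrite (le_trans (lerD E_le err)) // /G mulrDr expRD.
  apply: (@le_trans _ _ (expR (h * lam_bound) * (1 + h * C1))); last first.
    by rewrite ler_wpM2l ?expR_ge0 // expR_ge1Dx.
  rewrite mulrDr mulr1 lerD2l mulrC -[leLHS]mul1r; apply: ler_pM => //.
  - by rewrite mulr_ge0 // ltW.
  - by rewrite -expR0 ler_expR mulr_ge0 // ltW.
  - by rewrite ler_wpM2r // exprS ler_piMr ?exprn_ile1 ?(ltW h_gt0).
have G_ge1 : 1 <= G
  by rewrite -expR0 ler_expR; apply: mulr_ge0; [exact: ltW|exact: addr_ge0].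
have Gn : G ^+ n <= expR (T * (lam_bound + C1)).
  by rewrite -expRM_natl ler_expR mulrA ler_wpM2r // addr_ge0.
rewrite subrXX; apply: (@le_trans _ _ (C1 * h ^+ 5 * (n%:R * G ^+ n))).
  apply: normcM_le => //; rewrite (le_trans (le_normc_sum _ _ _)) //.
  apply: (@le_trans _ _ (\sum_(i < n) G ^+ n)); last first.
    by rewrite sumr_const card_ord mulr_natl.
  apply: ler_sum => i _.
  have -> : G ^+ n = G ^+ (n.-1 - i) * G ^+ i * G.
    rewrite -exprD subnK -?exprSr ?prednK //; first exact: (leq_trans _ (ltn_ord i)).
    by rewrite -ltnS prednK // (leq_trans _ (ltn_ord i)).
  rewrite -[leLHS]mulr1; apply: ler_pM => //; first exact: normc_ge0.
  by apply: normcM_le; exact: normcX_le.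
rewrite (_ : C1 * h ^+ 5 * _ = C1 * h ^+ 4 * ((n%:R * h) * G ^+ n)); last by ring.
rewrite (_ : T * C1 * _ * _ = C1 * h ^+ 4 * (T * expR (T * (lam_bound + C1)))); last by ring.
apply: ler_wpM2l; first by rewrite mulr_ge0 ?exprn_ge0 // ltW.
by apply: ler_pM; rewrite ?exprn_ge0 ?expR_ge0 // ?mulr_ge0 // ltW.
Qed.

End OneStep.

Theorem theorem5p7 (R : realType) (N : 'cV[R[i]]_2 -> R) (a c K eps0 gamma : R)
    (zeta : R -> R[i] -> R[i]) :
  is_norm N ->
  c ^+ 2 < a ^+ 2 ->
  0 < K ->
  0 < eps0 ->
  (forall kappa : R, `|kappa| <= K ->
     zeta_branch a c eps0 (0 +i* kappa) (fun eps => zeta eps (0 +i* kappa))) ->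
  0 < gamma ->
  (forall kappa eps : R, `|kappa| <= K -> 0 <= eps <= eps0 ->
     gamma%:C <= `|zeta eps (0 +i* kappa)|) ->
  forall T : R, 0 < T ->
  exists C_T h0 : R, 0 < h0 /\
    forall kappa eps h : R,
      `|kappa| <= K -> 0 < eps <= eps0 -> 0 < h <= h0 ->
      let d := 0 +i* kappa in
      forall (U0 : 'cV[R[i]]_2) (n : nat), n%:R * h <= T ->
        N (R_SFRC a c h eps d (zeta eps d) ^+ n *m U0
           - expmx ((n%:R * h)%:C *: mxL a c eps d) *m U0)
        <= C_T * h ^+ 4 * N U0.
Proof.
move=> normN _ _ _ branch gamma_gt0 zeta_ge T T_gt0.
have [cN cN_ge0 cNP] := norm_mulmx_le normN.
pose C1 := local_error_const a c K eps0 gamma.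
pose G := T * C1 * expR (T * (lam_bound a c K eps0 + C1)).
exists (cN * (Pi_s_bound a c K eps0 gamma * G)), 1; split=> //.
move=> kappa eps h kappa_le /andP[eps_gt0 eps_le] /andP[h_gt0 h_le1] d U0 n nhT.
have epsI : 0 <= eps <= eps0 by rewrite ltW.
have z1_ge := normc_1Dzeta_ge1 (branch _ kappa_le) gamma_gt0
  (fun t => zeta_ge kappa t kappa_le) epsI.
have [_ _ /(_ _ epsI) zeta_sqr] := branch _ kappa_le.
have z_ge : gamma <= normc (zeta eps d) by rewrite -lecR -normcE_norm; exact: zeta_ge.
rewrite -mulmxBl (R_SFRC_error eps_gt0 h_gt0 gamma_gt0 zeta_sqr z_ge z1_ge).
rewrite (_ : cN * _ * _ * _ = cN * (G * h ^+ 4 * Pi_s_bound a c K eps0 gamma) * N U0); last by ring.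
apply: cNP => i j; rewrite mxE; apply: normcM_le.
  exact: multiplier_pow_error.
exact: Pi_s_le.
Qed.
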